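(* Let $k$ be a positive integer and let $n\ge 3$ be an integer with $k\le\lfloor n/2\rfloor$. Then the cycle $C_n$ is $\{k\}$-distance magic if and only if $n=4k$.
   Context: $C_n$ denotes the cycle on $n\ge 3$ vertices; its diameter is $\lfloor n/2\rfloor$. Let $G=(V,E)$ be a finite simple undirected graph with $v=|V|$ vertices, and let $d(x,y)$ be the graph distance. For a set $D$ of nonnegative integers and $x\in V$, put $N_D(x)=\{y\in V : d(x,y)\in D\}$. A $D$-distance magic labeling of $G$ is a bijection $f:V\to\{1,2,\ldots,v\}$ for which there is a constant $\mathsf{k}$ such that $\sum_{y\in N_D(x)} f(y)=\mathsf{k}$ for every $x\in V$. $G$ is called $D$-distance magic if it admits a $D$-distance magic labeling. *)

(* Defs.v *)
From mathcomp Require Import all_boot.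

Set Implicit Arguments.
Unset Strict Implicit.
Unset Printing Implicit Defensive.

Record sgraph := SGraph {
  vertex :> finType;
  adj : rel vertex;
  adj_sym : symmetric adj;
  adj_irrefl : irreflexive adj }.

Section Distance.
Variable G : sgraph.
Implicit Types (x y : G) (m : nat).

Definition has_walk m x y : bool :=
  [exists p : m.-tuple G, path (@adj G) x p && (last x p == y)].

(* A shortest walk has length less than the number of vertices, so the search
   may stop there; the value None stands for infinite distance. *)
Definition gdist x y : option nat :=
  ohead [seq m <- iota 0 #|G| | has_walk m x y].

Lemma has_walkP m x y :
  reflect (exists p : seq G, [/\ size p = m, path (@adj G) x p & last x p = y])
          (has_walk m x y).
Proof.
apply: (iffP existsP) => [[p /andP[pth /eqP lst]]|[p [/eqP sz pth lst]]].
  by exists p; rewrite size_tuple.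
by exists (Tuple sz); rewrite /= pth lst eqxx.
Qed.

Lemma has_walk_short m x y :
  has_walk m x y -> exists2 j, j <= m & (j < #|G|) && has_walk j x y.
Proof.
move=> /has_walkP[p [<- pth <-]].
case: (shortenP pth) => q qpth quniq qp.
exists (size q).
  by apply: uniq_leq_size => //; case/andP: quniq.
apply/andP; split; last by apply/has_walkP; exists q.
by rewrite -[(size q).+1]/(size (x :: q)) -(card_uniqP quniq) max_card.
Qed.

Lemma gdistP x y m :
  gdist x y = Some m <->
  has_walk m x y /\ (forall j, has_walk j x y -> m <= j).
Proof.
rewrite /gdist; set s := filter _ _.
have s_sorted : sorted ltn s by rewrite sorted_filter ?iota_ltn_sorted //; exact: ltn_trans.
have mem_s j : (j \in s) = (j < #|G|) && has_walk j x y.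
  by rewrite mem_filter mem_iota andbC.
case: s s_sorted mem_s => [|h t] /= s_sorted mem_s; split => //.
- by case=> /has_walk_short[j _]; rewrite -mem_s.
- case=> <-; have /andP[_ wh] : (h < #|G|) && has_walk h x y.
    by rewrite -mem_s mem_head.
  split=> // i /has_walk_short[j le_ji]; rewrite -mem_s inE => /orP[/eqP<- //|jt].
  apply: leq_trans le_ji; apply: ltnW.
  by move: s_sorted; rewrite (path_sortedE ltn_trans) => /andP[/allP/(_ j jt)].
case=> wm min_m; congr Some; apply/eqP; rewrite eqn_leq.
have /andP[_ wh] : (h < #|G|) && has_walk h x y by rewrite -mem_s mem_head.
rewrite min_m // andbT; have [j le_jm] := has_walk_short wm.
rewrite -mem_s inE => /orP[/eqP<- //|jt]; apply: leq_trans le_jm; apply: ltnW.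
by move: s_sorted; rewrite (path_sortedE ltn_trans) => /andP[/allP/(_ j jt)].
Qed.

End Distance.

Definition dist_nbhd (G : sgraph) (D : pred nat) (x : G) : {set G} :=
  [set y | if gdist x y is Some m then m \in D else false].

Definition distance_magic_labeling (G : sgraph) (D : pred nat) (f : G -> nat) :
    Prop :=
  [/\ injective f,
      forall m, (1 <= m <= #|G|) <-> (exists x, f x = m)
    & exists c, forall x, \sum_(y in dist_nbhd D x) f y = c].

Definition distance_magic (G : sgraph) (D : pred nat) : Prop :=
  exists f : G -> nat, distance_magic_labeling D f.

Definition cycle_adj n : rel 'I_n :=
  [rel i j | (j == ordS i) || (i == ordS j)].

Lemma cycle_adj_sym n : symmetric (@cycle_adj n).
Proof. by move=> i j; rewrite /cycle_adj /= orbC. Qed.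

Lemma cycle_adj_irrefl n : 2 < n -> irreflexive (@cycle_adj n).
Proof.
move=> n_gt2 i; rewrite /cycle_adj /= orbb; apply/eqP => /(congr1 val) /=.
have := ltn_ord i; rewrite leq_eqVlt => /orP[/eqP def_n|lt_in].
  by rewrite def_n modnn => i0; move: n_gt2; rewrite -def_n i0.
by rewrite modn_small // => /eqP; rewrite ltn_eqF.
Qed.

Definition cycle_graph n (n_gt2 : 2 < n) : sgraph :=
  SGraph (@cycle_adj_sym n) (cycle_adj_irrefl n_gt2).

(* Main.v *)
Require Import Defs.
From mathcomp Require Import all_boot.
From mathcomp Require Import zify.

(** Write [iter j ordS x] for the vertex reached from [x] by [j] steps in the
    positive direction of the cycle.  As [k <= n./2], walking [k] steps in one
    direction is a shortest way to the vertex reached, so the vertices at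
    distance [k] from [iter k ordS x] are exactly [x] and
    [iter (k + k) ordS x] ([dist_nbhd_cycle]).  Every vertex is such a midpoint,
    so a labeling [f] is magic if and only if
    [f x + f (iter (k + k) ordS x)] does not depend on [x], provided that the
    two neighbours differ.

    If [n = 2k] they coincide, and the magic condition makes [f] constant,
    against injectivity.  If [2k < n], the condition at [x] and at
    [iter (k + k) ordS x] gives the same label to [x] and to its translate by
    [4k]; by injectivity [n] divides [4k], and [0 < 4k < 2n] leaves only
    [n = 4k].

    Conversely, for [n = 4k], translation by [2k] is the antipodal map, and it
    suffices to label antipodal vertices by pairs [(m, n + 1 - m)]
    ([antipodal_label]). *)

Lemma iter_ordS_val n j (x : 'I_n) : iter j (@ordS n) x = (x + j) %% n :> nat.
Proof.
elim: j => [|j IHj] /=; first by rewrite addn0 modn_small.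
by rewrite IHj -addn1 modnDml addn1 addnS.
Qed.

Lemma iter_ordS_eq n a b (x : 'I_n) :
  iter a (@ordS n) x = iter b (@ordS n) x <-> a = b %[mod n].
Proof.
split=> [/(congr1 val) /eqP | /eqP eq_ab].
  by rewrite /= !iter_ordS_val eqn_modDl => /eqP.
by apply: val_inj; rewrite /= !iter_ordS_val; apply/eqP; rewrite eqn_modDl.
Qed.

Lemma iter_ordS_inj n j : injective (iter j (@ordS n)).
Proof. by elim: j => [|j IHj] x y //= /ordS_inj/IHj. Qed.

Lemma iter_ordS_onto n k (y : 'I_n) : exists x, y = iter k (@ordS n) x.
Proof.
by have [g _ gK] := injF_bij (@iter_ordS_inj n k); exists (g y); rewrite gK.
Qed.

Section CycleDistance.
Variables (n : nat) (n_gt2 : 2 < n).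
Local Notation C := (cycle_graph n_gt2).
Local Notation shift j x := (iter j (@ordS n) x : C).

(** Positive and negative steps commute, so only their numbers [a] and [b]
    matter; the negative ones are moved to the side of [y] to avoid
    subtraction. *)
Lemma cycle_walk_steps m (x y : C) :
  has_walk m x y -> exists a b, a + b = m /\ shift a x = shift b y.
Proof.
case/has_walkP=> p [<- pth <-]; elim: p x pth => [|z p IHp] x /=.
  by exists 0, 0.
case/andP=> xz /IHp[a [b [<- eq_ab]]].
case/orP: xz => /eqP def; rewrite def in eq_ab *.
  by exists a.+1, b; rewrite iterSr.
by exists a, b.+1; rewrite addnS iterS -eq_ab -iterSr.
Qed.

Lemma cycle_walk_forward j (x : C) : has_walk j x (shift j x).
Proof.
apply/has_walkP; exists (traject (@ordS n) (ordS x) j).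
split; [exact: size_traject | | by rewrite last_traject].
apply: sub_path (fpath_traject _ _ _) => u v /= /eqP <-.
by rewrite /cycle_adj /= eqxx.
Qed.

Lemma cycle_walk_backward j (x : C) : has_walk j (shift j x) x.
Proof.
elim: j => [|j /has_walkP[p [sz pth lst]]].
  by apply/has_walkP; exists [::].
apply/has_walkP; exists (shift j x :: p).
by split; rewrite /= ?sz // pth /cycle_adj /= eqxx orbT.
Qed.

(** Up to symmetry, a walk shorter than [k] would give [k + b = a] modulo [n]
    with [a + b < k], impossible since then [0 < k + b - a < 2k <= n]. *)
Lemma cycle_walk_ge k j (x : C) : k <= n./2 ->
  has_walk j x (shift k x) \/ has_walk j (shift k x) x -> k <= j.
Proof.
move=> le_k w; rewrite leqNgt; apply/negP => lt_jk.
have [a [b [def_j eq_ab]]] :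
  exists a b, a + b = j /\ shift a x = shift (b + k) x.
  case: w => /cycle_walk_steps[a [b [def_j eq_ab]]].
    by exists a, b; rewrite iterD.
  by exists b, a; rewrite iterD -eq_ab addnC.
move/iter_ordS_eq: eq_ab.
by rewrite !modn_small; lia.
Qed.

Lemma gdist_cycle k (x y : C) : k <= n./2 ->
  gdist x y = Some k <-> y = shift k x \/ x = shift k y.
Proof.
move=> le_k; rewrite gdistP; split; last first.
  case=> ->; split; rewrite ?cycle_walk_forward ?cycle_walk_backward //.
    by move=> j w; apply: (@cycle_walk_ge _ _ x) => //; left.
  by move=> j w; apply: (@cycle_walk_ge _ _ y) => //; right.
(* In a shortest walk steps of opposite directions do not both occur, since
   a pair of them could be cancelled. *)
case=> /cycle_walk_steps[a [b [<- eq_ab]]] min_k.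
case: (leqP b a) => [le_ba|/ltnW le_ab].
  have def_y : y = shift (a - b) x.
    by apply: (@iter_ordS_inj n b); rewrite -eq_ab -iterD subnKC.
  have := min_k (a - b); rewrite {1}def_y cycle_walk_forward => /(_ isT) le_abb.
  by left; rewrite def_y; congr (iter _ _ _); lia.
have def_x : x = shift (b - a) y.
  by apply: (@iter_ordS_inj n a); rewrite eq_ab -iterD subnKC.
have := min_k (b - a); rewrite {1}def_x cycle_walk_backward => /(_ isT) le_abb.
by right; rewrite def_x; congr (iter _ _ _); lia.
Qed.

(** Centring the neighbourhood at a translate [shift k x], which is no loss by
    [iter_ordS_onto], avoids backward translations. *)
Lemma dist_nbhd_cycle k (x : C) : k <= n./2 ->
  dist_nbhd (pred1 k) (shift k x) = [set x; shift (k + k) x].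
Proof.
move=> le_k; apply/setP => y; rewrite !inE.
transitivity (gdist (shift k x) y == Some k).
  by case: gdist.
apply/eqP/orP; rewrite gdist_cycle // -iterD.
  by case=> [->|/iter_ordS_inj->]; [right | left].
by case=> /eqP->; [right | left].
Qed.

End CycleDistance.

Lemma cycle_magic_order k n (n_gt2 : 2 < n) : 0 < k -> k <= n./2 ->
  distance_magic (cycle_graph n_gt2) (pred1 k) -> n = 4 * k.
Proof.
move=> k_gt0 le_k [f [f_inj _ [c magic]]].
have nbhd_sum x := magic (iter k (@ordS n) x).
pose x0 : 'I_n := Ordinal (ltnW (ltnW n_gt2)).
have [def_n|neq_2k] := eqVneq (k + k) n.
  have f_const (x : 'I_n) : f x = c.
    rewrite -(nbhd_sum x) dist_nbhd_cycle //.
    have -> : iter (k + k) (@ordS n) x = x.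
      by apply/(@iter_ordS_eq n (k + k) 0 x); rewrite def_n modnn mod0n.
    by rewrite setUid big_set1.
  have /f_inj/(@iter_ordS_eq n 1 0 x0) : f (iter 1 (@ordS n) x0) = f x0.
    by rewrite !f_const.
  by rewrite !modn_small; lia.
have f_opp (x : 'I_n) : f x + f (iter (k + k) (@ordS n) x) = c.
  rewrite -(nbhd_sum x) dist_nbhd_cycle // big_setU1 ?big_set1 //= inE.
  apply/eqP => /(@iter_ordS_eq n 0 (k + k) x).
  by rewrite !modn_small; lia.
have f_period : f x0 = f (iter (k + k + (k + k)) (@ordS n) x0).
  apply: (@addIn (f (iter (k + k) (@ordS n) x0))).
  by rewrite f_opp iterD addnC f_opp.
have : k + k + (k + k) = 0 %[mod n].
  by apply/(@iter_ordS_eq n _ 0 x0); apply: f_inj.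
rewrite mod0n => /eqP/dvdnP[q def_q].
(* [q = 0] and [q >= 2] contradict [0 < 4k] and [2k < n]. *)
case: q def_q => [|[|q]]; rewrite ?mulSn; lia.
Qed.

(** With [x = 2k + i] the value [6k - x] is [4k - i], which complements the
    label [i + 1] of the antipode of [x] to [4k + 1]. *)
Definition antipodal_label k (x : nat) := if x < 2 * k then x.+1 else 6 * k - x.

Lemma antipodal_label_inj k x y : x < 4 * k -> y < 4 * k ->
  antipodal_label k x = antipodal_label k y -> x = y.
Proof.
move=> lt_x lt_y; rewrite /antipodal_label.
by case: (ltnP x (2 * k)); case: (ltnP y (2 * k)); lia.
Qed.

Lemma antipodal_label_bounds k x : x < 4 * k ->
  0 < antipodal_label k x <= 4 * k.
Proof. by rewrite /antipodal_label; case: (ltnP x (2 * k)); lia. Qed.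

Lemma antipodal_label_onto k m : 0 < m <= 4 * k ->
  exists2 x, x < 4 * k & antipodal_label k x = m.
Proof.
move=> m_bounds; case: (leqP m (2 * k)) => le_m2k.
  by exists m.-1; rewrite /antipodal_label; [|case: ltnP]; lia.
by exists (6 * k - m); rewrite /antipodal_label; [|case: ltnP]; lia.
Qed.

Lemma antipodal_label_sum k x : x < 4 * k ->
  antipodal_label k x + antipodal_label k ((x + (k + k)) %% (4 * k))
    = (4 * k).+1.
Proof.
move=> lt_x; rewrite /antipodal_label; case: (ltnP x (2 * k)) => x_lt.
  by rewrite modn_small; [case: ltnP | ]; lia.
have -> : x + (k + k) = x - 2 * k + 4 * k by lia.
by rewrite modnDr modn_small; [case: ltnP | ]; lia.
Qed.

Lemma antipodal_label_magic k (n_gt2 : 2 < 4 * k) :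
  distance_magic_labeling (G := cycle_graph n_gt2) (pred1 k)
    (fun x : 'I_(4 * k) => antipodal_label k x).
Proof.
split.
- move=> x y /antipodal_label_inj eq_xy; apply: ord_inj.
  by apply: eq_xy; exact: ltn_ord.
- move=> m; rewrite card_ord; split=> [/antipodal_label_onto[x lt_x <-]|[x <-]].
    by exists (Ordinal lt_x).
  by apply: antipodal_label_bounds; exact: ltn_ord.
exists (4 * k).+1 => y; have [x ->] := iter_ordS_onto _ k y.
rewrite dist_nbhd_cycle; last by lia.
rewrite big_setU1 /= ?big_set1 ?iter_ordS_val.
  by apply: antipodal_label_sum; exact: ltn_ord.
rewrite inE; apply/eqP => /(@iter_ordS_eq _ 0 (k + k) x).
by rewrite !modn_small; lia.
Qed.

Theorem theorem3 (k n : nat) (k_gt0 : 0 < k) (n_gt2 : 2 < n)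
    (le_k_diam : k <= n./2) :
  distance_magic (cycle_graph n_gt2) (pred1 k) <-> n = 4 * k.
Proof.
split=> [|def_n]; first exact: cycle_magic_order.
subst n; eexists; exact: antipodal_label_magic.
Qed.
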